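(* Let $K$ be a field, let $w\ge 2$ be an integer, and let $\mathcal{H}_w$ be the set of all numerical semigroups $H$ with $\operatorname{wd}(H)\le w$. Then for any integer $i\ge 0$ there exists an integer $b$ such that $\beta_i(I_H^* )\le b$ for all $H\in\mathcal{H}_w$.
   Context: A numerical semigroup is a subsemigroup $H\subset\mathbb{N}$ with $0\in H$ (the gcd of its elements is not required to be $1$); it has a unique minimal system of generators $a_1<\dots<a_r$ (positive integers). Its width is $\operatorname{wd}(H)=a_r-a_1$. With $S=K[x_1,\dots,x_r]$, $I_H\subset S$ is the kernel of the $K$-algebra map $S\to K[t]$, $x_i\mapsto t^{a_i}$. For a nonzero polynomial $f$, $f^*$ is its nonzero homogeneous component of least degree (standard grading), and $I_H^*=(f^*: f\in I_H, f\neq 0)$. Betti numbers are $\beta_i(M)=\dim_K\operatorname{Tor}_i^S(M,K)$ with $K=S/(x_1,\dots,x_r)$. *)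

(* Defs.v *)
From mathcomp Require Import all_boot all_order all_algebra.
From mathcomp.multinomials Require Import mpoly.

Set Implicit Arguments.
Unset Strict Implicit.
Unset Printing Implicit Defensive.

Import GRing.Theory.
Local Open Scope ring_scope.

Record numerical_semigroup (H : nat -> Prop) : Prop := NumericalSemigroup {
  numerical_semigroup0 : H 0%N;
  numerical_semigroupD : forall x y, H x -> H y -> H (x + y)%N }.

Definition generates (a : seq nat) (H : nat -> Prop) : Prop :=
  forall h, H h <->
    exists c : 'I_(size a) -> nat, h = (\sum_(j < size a) c j * nth 0%N a j)%N.

(* Listing the generators increasingly makes [a] a function of [H]. *)
Record minimal_generators (a : seq nat) (H : nat -> Prop) : Prop :=
  MinimalGenerators {
    mingen_pos : all (ltn 0) a;
    mingen_sorted : sorted ltn a;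
    mingen_generates : generates a H;
    mingen_minimal : forall b : seq nat,
      {subset b <= a} -> generates b H -> {subset a <= b} }.

(* The trivial semigroup {0} has no generator; it gets width 0. *)
Definition width (a : seq nat) : nat := (last 0 a - head 0 a)%N.

Section MultivariatePolynomials.
Variables (K : fieldType) (r : nat).
Local Notation S := {mpoly K[r]}.

(* Least degree of a monomial of [f], for [f != 0]. *)
Definition initial_degree (f : S) : nat :=
  \big[minn/msize f]_(m <- msupp f) mdeg m.

Definition initial_form (f : S) : S := pihomog mdeg (initial_degree f) f.

Definition ideal_span (G : S -> Prop) (f : S) : Prop :=
  exists2 s : seq (S * S), (forall cg, cg \in s -> G cg.2) &
    f = \sum_(cg <- s) cg.1 * cg.2.

Definition initial_ideal (I : S -> Prop) : S -> Prop :=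
  ideal_span (fun g => exists f, [/\ I f, f != 0 & g = initial_form f]).

(* A chain of free modules of finite rank over S,
     ... -> S^(rk 2) -> S^(rk 1) -> S^(rk 0) -> S,
   elements being row vectors on which the matrices act from the right. *)
Record free_chain := FreeChain {
  rk : nat -> nat;
  aug : 'cV[S]_(rk 0);
  diff : forall k, 'M[S]_(rk k.+1, rk k) }.

(* [F] is a free resolution of the S-module [M], a submodule of S. Every ideal
   of S has such a resolution, S being Noetherian. *)
Record free_resolution (M : S -> Prop) (F : free_chain) : Prop :=
  FreeResolution {
    aug_image : forall f, M f <-> exists u : 'rV_(rk F 0), u *m aug F = f%:M;
    exact_aug : forall u : 'rV_(rk F 0),
      u *m aug F = 0 <-> exists v, u = v *m diff F 0;
    exact_diff : forall k (u : 'rV_(rk F k.+1)),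
      u *m diff F k = 0 <-> exists v, u = v *m diff F k.+1 }.

(* The functor - (x)_S S/(x_1, ..., x_r) sends S^n to K^n and a matrix over S to
   the matrix of the constant coefficients of its entries. *)
Definition diff_res (F : free_chain) k : 'M[K]_(rk F k.+1, rk F k) :=
  map_mx (mcoeff 0%MM) (diff F k).

Definition cycles (F : free_chain) i : 'M[K]_(rk F i) :=
  match i with
  | 0 => 1%:M
  | k.+1 => kermx (diff_res F k)
  end.

(* dim_K H_i(F (x)_S K); the boundaries [diff_res F i] lie in the cycles when
   [F] is a complex, so the subtraction is that of the integers. *)
Definition tor_dim (F : free_chain) i : nat :=
  (\rank (cycles F i) - \rank (diff_res F i))%N.

(* n = dim_K Tor_i^S(M, K): the module has a free resolution, and all of them
   give n. *)
Definition is_betti (M : S -> Prop) i (n : nat) : Prop :=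
  (exists F, free_resolution M F) /\
  (forall F, free_resolution M F -> tor_dim F i = n).

End MultivariatePolynomials.

(* Kernel of K[x_0, ..., x_(r-1)] -> K[t], x_j |-> t^(a_j). *)
Definition semigroup_ideal (K : fieldType) (a : seq nat)
    (f : {mpoly K[size a]}) : Prop :=
  mmap (@polyC K) (fun j : 'I_(size a) => 'X^(nth 0%N a j)) f = 0.
Arguments semigroup_ideal : clear implicits.

(* Main.v *)
(* The idea is to bound the number of elements of a Groebner basis of I_H^* in
   terms of the width w alone, and then to use Schreyer's theorem: the syzygies
   of a Groebner basis with N elements have a Groebner basis with at most N^2
   elements, whence a free resolution whose i-th module has rank at most
   N^(2^i). Betti numbers are bounded by these ranks.

   Write sdeg m for the image of x^m in N, i.e. x^m |-> t^(sdeg m). The leading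
   monomials of I_H^* are the monomials m for which some n with the same sdeg is
   either of larger degree, or of the same degree and smaller in the monomial
   order; call such m nonstandard. With an order in which x_2, ..., x_(r-1)
   count first, the homogeneous relation x_j^w' = x_1^(a_r - a_j) x_r^(a_j - a_1),
   where w' = a_r - a_1, bounds by w' the exponents of x_2, ..., x_(r-1) in a
   minimal nonstandard monomial m. If moreover x_1 and x_r both divide m, the best
   monomial n with the sdeg of m is divisible by neither (cancel the common
   variable), so deg m <= deg n <= r w'. Hence m has at most one large exponent,
   that of x_1 or of x_r, and by minimality m is determined by its exponents
   truncated at a bound that depends on w only. *)

From Stdlib Require Import ClassicalEpsilon.
Require Import Defs.
From mathcomp Require Import all_boot all_order all_algebra.
From mathcomp.multinomials Require Import mpoly.

Set Implicit Arguments.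
Unset Strict Implicit.
Unset Printing Implicit Defensive.

Import GRing.Theory.
Local Open Scope ring_scope.

(** * Independence of the Betti numbers from the resolution *)

Section Comparison.
Variables (K : fieldType) (r : nat).
Local Notation S := {mpoly K[r]}.
Implicit Types (F G : free_chain K r) (M : S -> Prop).

(** Free modules are projective: the basis vectors of S^m are lifted one by one, and the lifts
    become the rows of [C]. *)
Lemma rows_lift (m n p : nat) (A : 'M[S]_(p, n)) (B : 'M[S]_(m, n)) :
  (forall u : 'rV_m, exists v : 'rV_p, u *m B = v *m A) ->
  exists C : 'M_(m, p), B = C *m A.
Proof.
move=> hB; have [f hf] := fin_all_exists (fun i => hB (delta_mx 0 i)).
exists (\matrix_i f i); apply/row_matrixP=> i.
by rewrite row_mul rowK -hf rowE.
Qed.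

Lemma resolution_rows_lift M F k (m : nat) (B : 'M[S]_(m, rk F k.+1)) :
  free_resolution M F -> B *m diff F k = 0 ->
  exists C : 'M_(m, rk F k.+2), B = C *m diff F k.+1.
Proof.
move=> resF B0; apply: rows_lift => u.
by apply/(exact_diff resF); rewrite -mulmxA B0 mulmx0.
Qed.

Lemma resolution_rows_lift0 M F (m : nat) (B : 'M[S]_(m, rk F 0)) :
  free_resolution M F -> B *m aug F = 0 ->
  exists C : 'M_(m, rk F 1), B = C *m diff F 0.
Proof.
move=> resF B0; apply: rows_lift => u.
by apply/(exact_aug resF); rewrite -mulmxA B0 mulmx0.
Qed.

Lemma resolution_aug_lift M F G : free_resolution M F -> free_resolution M G ->
  exists phi : 'M_(rk F 0, rk G 0), aug F = phi *m aug G.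
Proof.
move=> resF resG; apply: rows_lift => u.
have := proj2 (aug_image resF _) (ex_intro _ u (mx11_scalar (u *m aug F))).
by move=> /(aug_image resG) [v hv]; exists v; rewrite hv -mx11_scalar.
Qed.

Lemma diff_comp M F k : free_resolution M F -> diff F k.+1 *m diff F k = 0.
Proof.
move=> resF; apply/row_matrixP=> i; rewrite row_mul row0.
by apply/(exact_diff resF); exists (delta_mx 0 i); rewrite -rowE.
Qed.

Lemma diff_aug M F : free_resolution M F -> diff F 0 *m aug F = 0.
Proof.
move=> resF; apply/row_matrixP=> i; rewrite row_mul row0.
by apply/(exact_aug resF); exists (delta_mx 0 i); rewrite -rowE.
Qed.

(** Comparison maps and homotopy are built together by induction on the degree. The identity [diff F
    k *m (1%:M - phi *m psi - h *m diff F k) = 0] is what lets exactness produce the next homotopy;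
    the [match] records the homotopy identity, which has one term fewer in degree 0. *)
Lemma comparison_homotopy M F G k :
  free_resolution M F -> free_resolution M G ->
  exists (phi : 'M_(rk F k, rk G k)) (psi : 'M_(rk G k, rk F k))
    (h : 'M_(rk F k, rk F k.+1))
    (phi' : 'M_(rk F k.+1, rk G k.+1)) (psi' : 'M_(rk G k.+1, rk F k.+1)),
  [/\ diff F k *m phi = phi' *m diff G k,
      diff G k *m psi = psi' *m diff F k,
      diff F k *m (1%:M - phi *m psi - h *m diff F k) = 0 &
      match k return 'M_(rk F k, rk G k) -> 'M_(rk G k, rk F k) ->
        'M_(rk F k, rk F k.+1) -> Prop with
      | 0 => fun phi psi h => 1%:M - phi *m psi = h *m diff F 0
      | l.+1 => fun phi psi h =>
          exists (h0 : 'M_(rk F l, rk F l.+1)) (phi0 : 'M_(rk F l, rk G l)),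
          1%:M - phi *m psi = h *m diff F l.+1 + diff F l *m h0
          /\ diff F l *m phi0 = phi *m diff G l
      end phi psi h].
Proof.
move=> resF resG.
elim: k => [|k [phi [psi [h [phi' [psi' [cphi cpsi hk _]]]]]]].
  have [phi hphi] := resolution_aug_lift resF resG.
  have [psi hpsi] := resolution_aug_lift resG resF.
  have [|h hh] := @resolution_rows_lift0 M F _ (1%:M - phi *m psi) resF.
    by rewrite mulmxBl mul1mx -mulmxA -hpsi -hphi subrr.
  have [|phi' hphi'] := @resolution_rows_lift0 M G _ (diff F 0 *m phi) resG.
    by rewrite -mulmxA -hphi (diff_aug resF).
  have [|psi' hpsi'] := @resolution_rows_lift0 M F _ (diff G 0 *m psi) resF.
    by rewrite -mulmxA -hpsi (diff_aug resG).
  exists phi, psi, h, phi', psi'; split=> //.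
  by rewrite hh subrr mulmx0.
have [|phi2 hphi2] := @resolution_rows_lift M G k _ (diff F k.+1 *m phi') resG.
  by rewrite -mulmxA -cphi mulmxA (diff_comp _ resF) mul0mx.
have [|psi2 hpsi2] := @resolution_rows_lift M F k _ (diff G k.+1 *m psi') resF.
  by rewrite -mulmxA -cpsi mulmxA (diff_comp _ resG) mul0mx.
have [|h' hh'] :=
  @resolution_rows_lift M F k _ (1%:M - phi' *m psi' - diff F k *m h) resF.
  move: hk; rewrite !mulmxBl !mulmxBr !mulmxA cphi mulmx1 mul1mx => <-.
  by rewrite -!mulmxA cpsi.
exists phi', psi', h', phi2, psi2; split=> //.
  by rewrite -hh' opprB addrC subrK mulmxA (diff_comp _ resF) mul0mx.
by exists h, phi; split=> //; rewrite -hh' subrK.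
Qed.

End Comparison.

(** * Homology after reduction modulo the variables *)

Section TorDim.
Variables (K : fieldType) (r : nat).
Local Notation S := {mpoly K[r]}.
Implicit Types (F G : free_chain K r) (M : S -> Prop).

Local Notation "A ^0" := (map_mx (mcoeff 0%MM) A) (at level 2, format "A ^0").

(** When B lies in Z, [phi] induces an injection of Z/B into Z'/B'. The proof counts ranks by
    rank-nullity for the maps to the cokernel of B'. *)
Lemma homology_dim_le (m n p q : nat) (Z : 'M[K]_m) (B : 'M[K]_(p, m))
    (Z' : 'M[K]_n) (B' : 'M[K]_(q, n))
    (phi : 'M[K]_(m, n)) :
  (Z *m phi <= Z')%MS -> (B' <= Z')%MS -> 
  (forall z : 'rV_m, (z <= Z)%MS -> (z *m phi <= B')%MS -> (z <= B)%MS) ->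
  (\rank Z - \rank B <= \rank Z' - \rank B')%N.
Proof.
move=> sZ sB hker.
have := mxrank_mul_ker Z (phi *m cokermx B').
have := mxrank_mul_ker Z' (cokermx B').
have -> : \rank (Z' :&: kermx (cokermx B'))%MS = \rank B'.
  apply/eqmx_rank; apply/andP; split.
    by apply/rV_subP=> v; rewrite sub_capmx sub_kermx -submxE => /andP[].
  by rewrite sub_capmx sB sub_kermx mulmx_coker eqxx.
have le1 : (\rank (Z :&: kermx (phi *m cokermx B'))%MS <= \rank B)%N.
  apply/mxrankS/rV_subP=> v; rewrite sub_capmx sub_kermx => /andP[vZ].
  by rewrite mulmxA -submxE; apply: hker.
have le2 : (\rank (Z *m (phi *m cokermx B')) <= \rank (Z' *m cokermx B'))%N.
  by rewrite mulmxA mxrankS ?submxMr.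
move=> <- <-; rewrite addnK leq_subLR addnC.
exact: leq_add.
Qed.

Lemma tor_dim_le M F G i : free_resolution M F -> free_resolution M G ->
  (tor_dim F i <= tor_dim G i)%N.
Proof.
move=> resF resG.
have [phi [psi [h [phi' [psi' [cphi cpsi _ hi]]]]]] :=
  comparison_homotopy i resF resG.
have complex k : diff_res G k.+1 *m diff_res G k = 0.
  by rewrite -map_mxM (diff_comp _ resG) map_mx0.
have cpsi0 : diff_res G i *m psi^0 = psi'^0 *m diff_res F i.
  by rewrite -!map_mxM cpsi.
(* Injectivity on homology: if z phi is a boundary then so is z phi psi, and z differs from the
   latter by a boundary. *)
have bdF (z : 'rV_(rk F i)) u :
    z - z *m phi^0 *m psi^0 = u *m diff_res F i ->
    (z *m phi^0 <= diff_res G i)%MS -> (z <= diff_res F i)%MS.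
  move=> hz /submxP[v hv]; apply/submxP; exists (v *m psi'^0 + u).
  by rewrite mulmxDl -hz hv -!mulmxA cpsi0 addrC subrK.
apply: (@homology_dim_le _ _ _ _ _ _ _ _ phi^0).
- case: i phi psi h phi' psi' cphi cpsi hi {cpsi0 bdF} => [|i] phi psi h
    phi' psi' cphi cpsi hi /=.
    exact: submx1.
  case: hi => h0 [phi0 [_ c0]].
  rewrite sub_kermx -mulmxA /diff_res -map_mxM -c0 map_mxM mulmxA.
  by rewrite mulmx_ker mul0mx.
- case: i {phi psi h phi' psi' cphi cpsi hi cpsi0 bdF} => [|i] /=.
    exact: submx1.
  by rewrite sub_kermx complex.
move=> z; case: i phi psi h phi' psi' cphi cpsi hi {cpsi0} z bdF => [|i] phi psi
  h phi' psi' cphi cpsi hi z bdF /=.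
  move=> _; apply: (bdF _ (z *m h^0)).
  by rewrite -!mulmxA -!map_mxM -hi map_mxB map_mx1 mulmxBr mulmx1.
rewrite sub_kermx => /eqP z0; case: hi => h0 [phi0 [hi _]].
apply: (bdF _ (z *m h^0)).
rewrite -!mulmxA -!map_mxM; move/(congr1 (fun A => z *m A^0)): hi.
rewrite map_mxB map_mx1 map_mxD !map_mxM mulmxBr mulmx1 mulmxDr !mulmxA.
by rewrite z0 mul0mx addr0.
Qed.

Lemma is_betti_tor_dim M F i : free_resolution M F ->
  is_betti M i (tor_dim F i).
Proof.
move=> resF; split=> [|G resG]; first by exists F.
by apply/eqP; rewrite eqn_leq !(tor_dim_le _ resF resG, tor_dim_le _ resG resF).
Qed.

Lemma tor_dim_rk F i : (tor_dim F i <= rk F i)%N.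
Proof. exact: leq_trans (leq_subr _ _) (rank_leq_row _). Qed.

End TorDim.

(** * Groebner bases of submodules of S^n and Schreyer's theorem *)

Record monomial_order (r : nat) := MonomialOrder {
  mo_lt :> rel 'X_{1..r};
  mo_irr : irreflexive mo_lt;
  mo_trans : transitive mo_lt;
  mo_total : forall m n, m != n -> mo_lt m n || mo_lt n m;
  mo_add2r : forall p m n, mo_lt (m + p)%MM (n + p)%MM = mo_lt m n;
  mo_wf : well_founded mo_lt }.

Lemma ex_max_seq (T : eqType) (lt : rel T) (s : seq T) :
  transitive lt -> (forall x y, x != y -> lt x y || lt y x) -> s != [::] ->
  exists2 x, x \in s & {in s, forall y, y != x -> lt y x}.
Proof.
move=> tr tot; elim: s => // x [|x' s] IHs _.
  by exists x; rewrite ?mem_head // => y; rewrite inE => /eqP-> /eqP.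
have [//|z zs zmax] := IHs.
have [xz|] := boolP (x == z).
  exists z; first by rewrite inE zs orbT.
  move=> y; rewrite inE => /predU1P[->|ys]; first by rewrite xz.
  exact: zmax.
move=> /[dup] xz /tot /orP[lxz|lzx].
  exists z; first by rewrite inE zs orbT.
  by move=> y; rewrite inE => /predU1P[-> _ //|ys]; apply: zmax.
exists x; first exact: mem_head.
move=> y; rewrite inE => /predU1P[->|ys]; first by rewrite eqxx.
have [->//|yz _] := eqVneq y z.
by apply: tr lzx; apply: zmax.
Qed.

Section ModuleKeys.
Variables (r : nat) (lt : monomial_order r).
Local Notation key := ('X_{1..r} * nat)%type.

(** All the free modules of the resolution share this one well-founded order on keys, into which
    each maps its monomials by [mkey]. *)
Definition klt (x y : key) : bool :=
  lt x.1 y.1 || (x.1 == y.1) && (x.2 < y.2)%N.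

Lemma klt_irr : irreflexive klt.
Proof. by move=> x; rewrite /klt mo_irr ltnn andbF. Qed.

Lemma klt_trans : transitive klt.
Proof.
move=> [y1 y2] [x1 x2] [z1 z2]; rewrite /klt /=.
case/orP=> [xy|/andP[/eqP-> xy]].
  case/orP=> [yz|/andP[/eqP<- _]]; last by rewrite xy.
  by rewrite (mo_trans xy yz).
case/orP=> [->//|/andP[-> yz]].
by rewrite (ltn_trans xy yz) orbT.
Qed.

Lemma klt_total x y : x != y -> klt x y || klt y x.
Proof.
case: x y => [x1 x2] [y1 y2]; rewrite -pair_eqE /= negb_and /klt /=.
have [->|/(mo_total lt) /orP[] ->] := eqVneq x1 y1; rewrite ?orbT //=.
by rewrite !mo_irr neq_ltn.
Qed.

Lemma klt_wf : well_founded klt.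
Proof.
case=> x1 x2; elim/(well_founded_ind (mo_wf lt)): x1 x2 => x1 IH1 x2.
elim/ltn_ind: x2 => x2 IH2; constructor=> -[y1 y2]; rewrite /klt /=.
case/orP=> [/IH1//|/andP[/eqP-> ]]; exact: IH2.
Qed.

Lemma klt_add2r m (x y : key) :
  klt ((x.1 + m)%MM, x.2) ((y.1 + m)%MM, y.2) = klt x y.
Proof. by rewrite /klt /= mo_add2r eqm_add2r. Qed.

(* The pair (j, m) stands for the monomial x^m e_j of S^n. Monomials are ordered
   by m + lam j, and then by tau j. *)
Definition mkey n (lam : 'I_n -> 'X_{1..r}) (tau : 'I_n -> nat)
  (x : 'I_n * 'X_{1..r}) : key := ((x.2 + lam x.1)%MM, tau x.1).

Lemma mkey_inj n lam (tau : 'I_n -> nat) :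
  injective tau -> injective (mkey lam tau).
Proof.
move=> itau [i m] [j p] /eqP; rewrite xpair_eqE => /andP[e /eqP /itau eij].
have {}eij : i = j := eij; have {}e : (m + lam i == p + lam j)%MM := e.
by move: e; rewrite eij eqm_add2r => /eqP->.
Qed.

Lemma mkeyD n lam (tau : 'I_n -> nat) j p m :
  mkey lam tau (j, p + m)%MM =
  (((mkey lam tau (j, p)).1 + m)%MM, (mkey lam tau (j, p)).2).
Proof. by rewrite /mkey -!addmA (addmC m). Qed.

Definition mlt n lam (tau : 'I_n -> nat) (x y : 'I_n * 'X_{1..r}) :=
  klt (mkey lam tau x) (mkey lam tau y).

End ModuleKeys.

Section Groebner.
Variables (K : fieldType) (r : nat) (lt : monomial_order r).
Local Notation S := {mpoly K[r]}.

Definition vcoef n (v : 'rV[S]_n) (x : 'I_n * 'X_{1..r}) : K :=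
  (v 0 x.1)@_x.2.

Record submodule n (M : 'rV[S]_n -> Prop) : Prop := Submodule {
  submodule0 : M 0;
  submoduleD : forall u v, M u -> M v -> M (u + v);
  submoduleZ : forall c u, M u -> M (c *: u) }.

Definition is_lead n lam (tau : 'I_n -> nat) (v : 'rV[S]_n) x :=
  vcoef v x != 0 /\
  forall y, vcoef v y != 0 -> y != x -> mlt lt lam tau y x.

Record groebner n (lam : 'I_n -> 'X_{1..r}) (tau : 'I_n -> nat)
    (M : 'rV[S]_n -> Prop) := Groebner {
  gb_size : nat;
  gb_mx : 'M[S]_(gb_size, n);
  gb_lead : 'I_gb_size -> 'I_n * 'X_{1..r};
  gb_in : forall i, M (row i gb_mx);
  gb_monic : forall i, vcoef (row i gb_mx) (gb_lead i) = 1;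
  gb_leadP : forall i, is_lead lam tau (row i gb_mx) (gb_lead i);
  gb_div : forall v x, M v -> is_lead lam tau v x ->
    exists i, (gb_lead i).1 = x.1 /\ ((gb_lead i).2 <= x.2)%MM }.

Arguments gb_lead {n lam tau M} g i.
Arguments gb_monic {n lam tau M} g i.
Arguments gb_leadP {n lam tau M} g i.
Arguments gb_in {n lam tau M} g i.
Arguments gb_div {n lam tau M} g [v x].

Lemma vcoefD n (u v : 'rV[S]_n) x : vcoef (u + v) x = vcoef u x + vcoef v x.
Proof. by rewrite /vcoef mxE mcoeffD. Qed.

Lemma vcoefN n (v : 'rV[S]_n) x : vcoef (- v) x = - vcoef v x.
Proof. by rewrite /vcoef mxE mcoeffN. Qed.

Lemma vcoefB n (u v : 'rV[S]_n) x : vcoef (u - v) x = vcoef u x - vcoef v x.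
Proof. by rewrite vcoefD vcoefN. Qed.

Lemma vcoef0 n x : vcoef (0 : 'rV[S]_n) x = 0.
Proof. by rewrite /vcoef mxE mcoeff0. Qed.

Lemma vcoefZ n c (v : 'rV[S]_n) x : vcoef (c%:MP *: v) x = c * vcoef v x.
Proof. by rewrite /vcoef mxE mcoeffCM. Qed.

Lemma vcoefZX n (v : 'rV[S]_n) m x :
  vcoef ('X_[m] *: v) x =
  if (m <= x.2)%MM then vcoef v (x.1, x.2 - m)%MM else 0.
Proof.
rewrite /vcoef mxE mulrC; case: ifP => mx.
  by rewrite -{1}(submK mx) addmC mcoeffMX.
apply/memN_msupp_eq0; rewrite (perm_mem (msuppMX _ _)).
by apply/mapP=> -[p _ hp]; rewrite hp lem_addr in mx.
Qed.

Lemma vcoef_delta n (i : 'I_n) m x :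
  vcoef ('X_[m] *: delta_mx 0 i) x = (x == (i, m))%:R.
Proof.
rewrite /vcoef !mxE eqxx; case: x => j p; rewrite xpair_eqE.
have [_|_] := eqVneq j i; last by rewrite mulr0 mcoeff0.
by rewrite mulr1 mcoeffX eq_sym.
Qed.

Lemma vcoefP n (u v : 'rV[S]_n) : (forall x, vcoef u x = vcoef v x) -> u = v.
Proof.
by move=> uv; apply/rowP=> j; apply/mpolyP=> m; apply: (uv (j, m)).
Qed.

Lemma ex_lead n lam (tau : 'I_n -> nat) (v : 'rV[S]_n) :
  injective tau -> v != 0 -> exists x, is_lead lam tau v x.
Proof.
move=> itau v0.
pose s := [seq (j, m) | j <- enum 'I_n, m <- msupp (v 0 j)].
have sP x : (x \in s) = (vcoef v x != 0).
  rewrite /vcoef -mcoeff_msupp; apply/allpairsPdep/idP.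
    by case=> j [m [_ hm ->]].
  by case: x => j m hm; exists j, m; rewrite mem_enum.
have tr : transitive (mlt lt lam tau) by move=> y x z; apply: klt_trans.
have tot x y : x != y -> mlt lt lam tau x y || mlt lt lam tau y x.
  by rewrite -(inj_eq (mkey_inj (lam := lam) itau)); apply: klt_total.
have [|x xs xmax] := ex_max_seq tr tot (s := s).
  apply: contra_neq v0 => s0; apply: vcoefP => x; apply/eqP.
  by rewrite vcoef0 -[_ == _]negbK -sP s0.
by exists x; split=> [|y]; rewrite -sP // => ys yx; apply: xmax.
Qed.

(** * Division by a Groebner basis *)

Section Division.
Variables (n : nat) (lam : 'I_n -> 'X_{1..r}) (tau : 'I_n -> nat).
Variables (M : 'rV[S]_n -> Prop).
Hypotheses (itau : injective tau) (subM : submodule M).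
Variable g : groebner lam tau M.
Local Notation N := (gb_size g).
Local Notation A := (gb_mx g).
Local Notation mk := (mkey lam tau).

Definition gb_pos i := (gb_lead g i).1.
Definition gb_mon i := (gb_lead g i).2.

Lemma monomial_multiple_coef (v : 'rV[S]_n) m x y : is_lead lam tau v x ->
  vcoef ('X_[m] *: v) y != 0 -> y != (x.1, x.2 + m)%MM ->
  mlt lt lam tau y (x.1, x.2 + m)%MM.
Proof.
case: y => j p [_ hx]; rewrite vcoefZX /=.
case: ifP => [mp|]; last by rewrite eqxx.
move=> hy ne.
have lt_jx : mlt lt lam tau (j, p - m)%MM x.
  by apply: hx hy _; apply: contraNneq ne => <- /=; rewrite submK.
by rewrite -{1}(submK mp) /mlt !mkeyD klt_add2r.
Qed.

(** The division algorithm, by well-founded induction on the bound: once the leading term is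
    cancelled, its key bounds the remainder. The bound on the monomials of [q] is what later
    controls the leading monomials of syzygies. *)
Lemma gb_divide v kap : M v ->
  (forall x, vcoef v x != 0 -> klt lt (mk x) kap) ->
  exists2 q : 'rV[S]_N, v = q *m A &
    forall l m, vcoef q (l, m) != 0 ->
      klt lt (mk (gb_pos l, m + gb_mon l)%MM) kap.
Proof.
elim/(well_founded_ind (klt_wf lt)): kap v => kap IH v Mv vkap.
have [->|v0] := eqVneq v 0.
  by exists 0; rewrite ?mul0mx // => l m; rewrite vcoef0 eqxx.
have [x lx] := ex_lead lam itau v0.
have [i [pi mi]] := gb_div g Mv lx.
have xkap : klt lt (mk x) kap by apply: vkap; case: lx.
pose c := vcoef v x; pose m := (x.2 - gb_mon i)%MM.
have xE : (gb_pos i, gb_mon i + m)%MM = x.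
  by rewrite /gb_pos pi addmC submK //; case: (x).
pose v' := v - c%:MP *: ('X_[m] *: row i A).
have Mv' : M v'.
  apply: submoduleD => //; rewrite -scaleNr scalerA.
  by apply: submoduleZ => //; apply: gb_in.
have v'x y : vcoef v' y != 0 -> klt lt (mk y) (mk x).
  rewrite vcoefB vcoefZ.
  have [->|yx] := eqVneq y x.
    have -> : vcoef ('X_[m] *: row i A) x = vcoef (row i A) (gb_lead g i).
      rewrite vcoefZX /m lem_subr submBA // addmC addmK -pi.
      by congr (vcoef _ _); rewrite -surjective_pairing.
    by rewrite gb_monic mulr1 subrr eqxx.
  have [->|vy _] := eqVneq (vcoef v y) 0; last by case: lx => _; apply.
  rewrite sub0r oppr_eq0 mulf_eq0 negb_or => /andP[_].
  move=> /(monomial_multiple_coef (gb_leadP g i)).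
  by rewrite -/(gb_pos i) -/(gb_mon i) xE; apply.
have [q qE qx] := IH _ xkap _ Mv' v'x.
exists (q + c%:MP *: ('X_[m] *: delta_mx 0 i)).
  by rewrite mulmxDl -qE -!scalemxAl -rowE subrK.
move=> l p; have [qlp0|/qx lx' _] := eqVneq (vcoef q (l, p)) 0; last first.
  exact: klt_trans lx' xkap.
rewrite vcoefD qlp0 add0r vcoefZ vcoef_delta.
have [[-> ->]|] := eqVneq (l, p) (i, m); last by rewrite mulr0 eqxx.
by move=> _; rewrite addmC xE.
Qed.

Lemma gb_spanP v : M v <-> exists q : 'rV[S]_N, q *m A = v.
Proof.
split=> [Mv|[q <-]]; last first.
  rewrite mulmx_sum_row; elim/big_rec: _ => [|i u _ Mu].
    exact: submodule0.
  by apply: submoduleD => //; apply: submoduleZ => //; apply: gb_in.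
have [->|v0] := eqVneq v 0; first by exists 0; rewrite mul0mx.
have [x [_ lx]] := ex_lead lam itau v0.
(* The bound in [gb_divide] is strict, so a key just above the leading one is taken. *)
have xkap : klt lt (mk x) ((mk x).1, (mk x).2.+1).
  by rewrite /klt /= eqxx ltnSn orbT.
have [|q -> _] := @gb_divide v ((mk x).1, (mk x).2.+1) Mv; last by exists q.
move=> y vy; have [->//|yx] := eqVneq y x.
exact: klt_trans (lx _ vy yx) xkap.
Qed.

End Division.

Lemma vcoefZ_neq0 n f (v : 'rV[S]_n) j p : vcoef (f *: v) (j, p) != 0 ->
  exists a b, [/\ p = (a + b)%MM, f@_a != 0 & vcoef v (j, b) != 0].
Proof.
rewrite /vcoef mxE -mcoeff_msupp => /msuppM_le/allpairsP[[a b] /= [fa vb ->]].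
by exists a, b; rewrite -!mcoeff_msupp.
Qed.

Definition syzygy n N (A : 'M[S]_(N, n)) (u : 'rV[S]_N) : Prop := u *m A = 0.

Lemma syzygy_submodule n N (A : 'M[S]_(N, n)) : submodule (syzygy A).
Proof.
split; rewrite /syzygy; first exact: mul0mx.
  by move=> u v u0 v0; rewrite mulmxDl u0 v0 addr0.
by move=> c u u0; rewrite -scalemxAl u0 scaler0.
Qed.

(** * Schreyer's theorem on syzygies *)

Section Schreyer.
Variables (n : nat) (lam : 'I_n -> 'X_{1..r}) (tau : 'I_n -> nat).
Variables (M : 'rV[S]_n -> Prop).
Hypotheses (itau : injective tau) (subM : submodule M).
Variable g : groebner lam tau M.
Local Notation N := (gb_size g).
Local Notation A := (gb_mx g).
Local Notation mk := (mkey lam tau).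
Local Notation p := (gb_pos (g := g)).
Local Notation mu := (gb_mon (g := g)).

(** Schreyer's order: x^a e_i is placed where the leading monomial of x^a times row i stands. *)
Definition schreyer_shift (i : 'I_N) := (mu i + lam (p i))%MM.
(** As i < N, this number encodes the lexicographic pair ([tau (p i)], i). Among equal leading
    monomials the larger index is thus the larger one. *)
Definition schreyer_rank (i : 'I_N) := (tau (p i) * N + i)%N.
Local Notation slt := (mlt lt schreyer_shift schreyer_rank).

Lemma schreyer_rank_ltn i l :
  (schreyer_rank i < schreyer_rank l)%N =
  (tau (p i) < tau (p l))%N || (p i == p l) && (i < l)%N.
Proof.
have aux (a b : nat) (k k' : 'I_N) : (a < b)%N -> (a * N + k < b * N + k')%N.
  move=> ab; apply: (@leq_trans (a.+1 * N)).
    by rewrite mulSn addnC ltn_add2r.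
  by apply: leq_trans (leq_addr _ _); rewrite leq_mul2r ab orbT.
rewrite /schreyer_rank -(inj_eq itau).
have [h|h|->] := ltngtP (tau (p i)) (tau (p l)); first exact: aux.
  by apply/negbTE; rewrite -leqNgt ltnW ?aux.
by rewrite ltn_add2l.
Qed.

Lemma schreyer_rank_inj : injective schreyer_rank.
Proof.
move=> i l il; have := schreyer_rank_ltn l i; have := schreyer_rank_ltn i l.
rewrite il ltnn => /esym/norP[h1 h2] /esym/norP[h3 h4].
have pE : p i = p l.
  by apply/itau/eqP; rewrite eqn_leq leqNgt h3 leqNgt h1.
move: h2 h4; rewrite pE eqxx /= -!leqNgt => h2 h4.
by apply/val_inj/eqP; rewrite eqn_leq h2 h4.
Qed.

Lemma schreyer_ltE i a l b : slt (i, a) (l, b) =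
  klt lt (mk (p i, a + mu i)%MM) (mk (p l, b + mu l)%MM) ||
  [&& p i == p l, (a + mu i == b + mu l)%MM & (i < l)%N].
Proof.
rewrite /mlt /klt /mkey /= /schreyer_shift !addmA schreyer_rank_ltn.
have [pE|pE] := eqVneq (p i) (p l); last by rewrite /= !orbF.
by rewrite pE ltnn eqm_add2r mo_add2r /= andbF orbF.
Qed.

Lemma schreyer_lt_key i a l b :
  klt lt (mk (p i, a + mu i)%MM) (mk (p l, b + mu l)%MM) -> slt (i, a) (l, b).
Proof. by rewrite schreyer_ltE => ->. Qed.

(* The coefficient of the leading monomial of [u] can only be cancelled in
   [u *m A] by that of a monomial of [u] with the same key. *)
Lemma schreyer_cancel u i m l a b :
  is_lead schreyer_shift schreyer_rank u (i, m) ->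
  (a + b = m + mu i)%MM ->
  vcoef u (l, a) != 0 -> vcoef (row l A) (p i, b) != 0 ->
  (l, a) = (i, m) \/ [/\ p l = p i, (a + mu l = m + mu i)%MM & (l < i)%N].
Proof.
move=> [_ ulead] abE ula Alb.
have [|la] := eqVneq (l, a) (i, m); [by left|right].
have := ulead _ ula la; rewrite schreyer_ltE.
case/orP=> [lt1|/and3P[/eqP ? /eqP ? ?]] //.
exfalso; move: lt1; rewrite -abE !(addmC a) !mkeyD klt_add2r.
have [->|ne] := eqVneq (p i, b) (p l, mu l); first by rewrite klt_irr.
have := (gb_leadP g l).2 _ Alb; rewrite (surjective_pairing (gb_lead g l)).
move=> /(_ ne) lt2 /(klt_trans lt2); by rewrite klt_irr.
Qed.

(** Otherwise, by [schreyer_cancel], the leading term of [u] would alone contribute to the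
    coefficient of [u *m A] at the leading monomial of x^m times row i, which could then not
    vanish. *)
Lemma syzygy_lead u i m : syzygy A u ->
  is_lead schreyer_shift schreyer_rank u (i, m) ->
  exists l, [/\ p l = p i, (mu l <= m + mu i)%MM & (l < i)%N].
Proof.
move=> uA ulead.
have [//|nol] := classic
  (exists l, [/\ p l = p i, (mu l <= m + mu i)%MM & (l < i)%N]).
have cancel l a b : (a + b = m + mu i)%MM ->
    vcoef u (l, a) != 0 -> vcoef (row l A) (p i, b) != 0 -> (l, a) = (i, m).
  move=> abE ula Alb.
  case: (schreyer_cancel ulead abE ula Alb) => // -[pE mE li].
  by case: nol; exists l; rewrite -mE lem_addl.
have := congr1 (fun v => vcoef v (p i, m + mu i)%MM) uA.
rewrite vcoef0 mulmx_sum_row.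
pose f := u 0 i - (u 0 i)@_m *: 'X_[m].
have -> : \sum_l u 0 l *: row l A =
  ((u 0 i)@_m)%:MP *: ('X_[m] *: row i A) +
  (f *: row i A + \sum_(l | l != i) u 0 l *: row l A).
  rewrite (bigD1 i) //= addrA; congr (_ + _).
  by rewrite scalerA -scalerDl mul_mpolyC addrC subrK.
rewrite vcoefD vcoefZ vcoefZX /= lem_addr addmC addmK.
have -> : vcoef (row i A) (p i, mu i) = 1.
  by rewrite -(gb_monic g i) [in RHS](surjective_pairing (gb_lead g i)).
rewrite mulr1 vcoefD.
have -> : vcoef (f *: row i A) (p i, mu i + m)%MM = 0.
  apply/eqP/contraT => /vcoefZ_neq0[a [b [abE fa Ab]]].
  move: fa; rewrite mcoeffB mcoeffZ mcoeffX.
  have [->|ma] := eqVneq m a; first by rewrite mulr1 subrr eqxx.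
  rewrite mulr0 subr0 => ua.
  case/eqP: ma; have [] // : (i, a) = (i, m).
  by apply: cancel Ab; rewrite // -abE addmC.
rewrite add0r (_ : vcoef (\sum_(l | l != i) _) _ = 0); last first.
  rewrite /vcoef summxE raddf_sum big1 // => l li.
  apply/eqP/contraT => /vcoefZ_neq0[a [b [abE ua Ab]]].
  have [/eqP] : (l, a) = (i, m) by apply: cancel Ab; rewrite // -abE addmC.
  by rewrite (negPf li).
by rewrite addr0 => /eqP; case: ulead => /negPf ->.
Qed.

(** In the S-pair of rows i and l the monomial L cancels, so division gives quotients whose keys
    stay below that of L. Subtracting them leaves a syzygy with two terms at L, and l < i makes the
    one at e_i leading. *)
Lemma spair_syzygy l i : p l = p i -> (l < i)%N ->
  let x := (i, mlcm (mu i) (mu l) - mu i)%MM in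
  exists s : 'rV[S]_N, [/\ syzygy A s, vcoef s x = 1 &
    is_lead schreyer_shift schreyer_rank s x].
Proof.
move=> pE li; set L := mlcm _ _; move=> x.
pose b := (L - mu l)%MM.
have xL : (x.2 + mu i)%MM = L by rewrite submK ?lem_mlcml.
have bL : (b + mu l)%MM = L by rewrite submK ?lem_mlcmr.
have bE : (mu l + b)%MM = L by rewrite addmC.
have xE : (mu i + x.2)%MM = L by rewrite addmC.
pose v := 'X_[x.2] *: row i A - 'X_[b] *: row l A.
have Mv : M v.
  apply: submoduleD => //; rewrite -?scaleNr; apply: submoduleZ => //;
  exact: gb_in.
have mon k m : (m + mu k)%MM = L -> vcoef ('X_[m] *: row k A) (p k, L) = 1.
  move=> <-; rewrite vcoefZX /= lem_addr addmC addmK -(gb_monic g k).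
  by rewrite [in RHS](surjective_pairing (gb_lead g k)).
have vL : vcoef v (p i, L) = 0.
  by rewrite vcoefB mon // -pE mon // subrr.
have vlt y : vcoef v y != 0 -> klt lt (mk y) (mk (p i, L)).
  have [->|yL] := eqVneq y (p i, L); first by rewrite vL eqxx.
  rewrite vcoefB.
  have [->|hy _] := eqVneq (vcoef ('X_[x.2] *: row i A) y) 0.
    rewrite sub0r oppr_eq0 => hy.
    have := monomial_multiple_coef (gb_leadP g l) hy.
    by rewrite -/(p l) -/(mu l) bE pE => /(_ yL).
  have := monomial_multiple_coef (gb_leadP g i) hy.
  by rewrite -/(p i) -/(mu i) xE => /(_ yL).
have [q qE qlt] := gb_divide itau subM g Mv vlt.
pose s := 'X_[x.2] *: delta_mx 0 i - 'X_[b] *: delta_mx 0 l - q.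
have qx : vcoef q x = 0.
  by apply/eqP/contraT => /qlt; rewrite xL klt_irr.
have sx : vcoef s x = 1.
  rewrite /s 2!vcoefB !vcoef_delta qx subr0 eqxx xpair_eqE -val_eqE /=.
  by rewrite gtn_eqF // subr0.
exists s; split=> //.
  by rewrite /syzygy !mulmxBl -!scalemxAl -!rowE -qE subrr.
split=> [|[k m]]; first by rewrite sx oner_eq0.
have [qkm|/qlt kL _ _] := eqVneq (vcoef q (k, m)) 0; last first.
  by apply: schreyer_lt_key; rewrite xL.
rewrite /s 2!vcoefB qkm subr0 !vcoef_delta => + /negPf km.
rewrite km sub0r oppr_eq0.
have [-> _|_] := eqVneq (k, m) (l, b); last by rewrite eqxx.
by rewrite schreyer_ltE bL xL pE !eqxx li orbT.
Qed.

Lemma schreyer : exists g' : groebner schreyer_shift schreyer_rank (syzygy A),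
  (gb_size g' <= N * N)%N.
Proof.
(* One S-pair for each pair of rows with leading monomials in the same position, hence at most N^2
   of them. *)
pose P := [set x : 'I_N * 'I_N | (p x.1 == p x.2) && (x.1 < x.2)%N].
have PP (k : 'I_#|P|) : p (enum_val k).1 = p (enum_val k).2 /\
    ((enum_val k).1 < (enum_val k).2)%N.
  by have := enum_valP k; rewrite inE => /andP[/eqP].
have [s hs] := fin_all_exists (fun k => spair_syzygy (PP k).1 (PP k).2).
unshelve eexists.
  apply: (@Groebner _ _ _ _ #|P| (\matrix_k s k) (fun k =>
    let: (l, i) := enum_val k in (i, mlcm (mu i) (mu l) - mu i)%MM)).
  - by move=> k; rewrite rowK; case: (hs k).
  - by move=> k; rewrite rowK; case: (hs k); case: enum_val.
  - by move=> k; rewrite rowK; case: (hs k); case: enum_val.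
  move=> u [i m] uA ulead; have [l [pE lm li]] := syzygy_lead uA ulead.
  have liP : (l, i) \in P by rewrite inE /= pE eqxx.
  exists (enum_rank_in liP (l, i)); rewrite enum_rankK_in //=; split=> //.
  apply/mnm_lepP=> j; rewrite mnmBE leq_subLR mnmE addnC.
  move/mnm_lepP: lm => /(_ j); rewrite mnmDE geq_max => ->.
  by rewrite leq_addl.
by rewrite /= (leq_trans (max_card _)) // card_prod card_ord.
Qed.

End Schreyer.

(** The ambient rank is bundled with the basis, so that passing to syzygies becomes an endomap that
    can be iterated. *)
Record schreyer_stage := SchreyerStage {
  st_n : nat;
  st_lam : 'I_st_n -> 'X_{1..r};
  st_tau : 'I_st_n -> nat;
  st_mod : 'rV[S]_st_n -> Prop;
  st_gb : groebner st_lam st_tau st_mod;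
  st_inj : injective st_tau;
  st_sub : submodule st_mod }.

Definition schreyer_gb (s : schreyer_stage) :=
  constructive_indefinite_description _
    (schreyer (@st_inj s) (st_sub s) (st_gb s)).

Definition next_stage (s : schreyer_stage) : schreyer_stage :=
  SchreyerStage (proj1_sig (schreyer_gb s))
    (schreyer_rank_inj (@st_inj s) (g := st_gb s)) (syzygy_submodule _).

Section Resolution.
Variables (I : S -> Prop) (lam : 'I_1 -> 'X_{1..r}) (tau : 'I_1 -> nat).
Hypothesis subI : submodule (fun v : 'rV[S]_1 => I (v 0 0)).
Variable g : groebner lam tau (fun v : 'rV[S]_1 => I (v 0 0)).

Let itau : injective tau. Proof. by move=> i j _; rewrite !ord1. Qed.

Let stage k := iter k next_stage (SchreyerStage g itau subI).

Definition schreyer_resolution : free_chain K r :=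
  @FreeChain K r (fun k => gb_size (st_gb (stage k))) (gb_mx g)
    (fun k => gb_mx (st_gb (stage k.+1))).

Lemma schreyer_resolutionP : free_resolution I schreyer_resolution.
Proof.
have syz k (u : 'rV_(gb_size (st_gb (stage k)))) :
    u *m gb_mx (st_gb (stage k)) = 0 <->
    exists v, u = v *m gb_mx (st_gb (stage k.+1)).
  have [to_span of_span] := gb_spanP (@st_inj (stage k.+1))
    (st_sub (stage k.+1)) (st_gb (stage k.+1)) u.
  split; first by move=> /to_span[v <-]; exists v.
  by case=> v hv; apply: of_span; exists v.
split=> [f|u|k u]; [|exact: (syz 0%N)|exact: (syz k.+1)].
have [to_span of_span] := gb_spanP itau subI g f%:M.
rewrite mxE eqxx in to_span of_span; split=> [/to_span|]; exact.
Qed.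

Lemma schreyer_resolution_rk k :
  (rk schreyer_resolution k <= gb_size g ^ 2 ^ k)%N.
Proof.
elim: k => [|k IHk]; first by rewrite expn0 expn1.
rewrite expnS mulnC expnM -[(_ ^ 2)%N]mulnn.
apply: leq_trans (leq_mul IHk IHk).
exact: (proj2_sig (schreyer_gb (stage k))).
Qed.

End Resolution.
End Groebner.

(** * Nonstandard monomials of a semigroup *)

Section WeightOrder.
Variables (r : nat) (om : 'X_{1..r} -> nat).
Hypothesis omD : forall m n, om (m + n)%MM = (om m + om n)%N.

Definition weight_lt : rel 'X_{1..r} :=
  fun m n => (om m < om n)%N || (om m == om n) && (m < n)%O.

Lemma weight_lt_irr : irreflexive weight_lt.
Proof. by move=> m; rewrite /weight_lt ltnn Order.POrderTheory.ltxx andbF. Qed.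

Lemma weight_lt_trans : transitive weight_lt.
Proof.
move=> n m p; rewrite /weight_lt => /orP[mn|/andP[/eqP-> mn]].
  by case/orP=> [np|/andP[/eqP<- _]]; rewrite ?mn ?(ltn_trans mn np).
case/orP=> [->//|/andP[-> np]].
by rewrite (Order.POrderTheory.lt_trans mn np) orbT.
Qed.

Lemma weight_lt_total m n : m != n -> weight_lt m n || weight_lt n m.
Proof.
move=> mn; rewrite /weight_lt; case: ltngtP => //= _.
by rewrite -Order.TotalTheory.neq_lt.
Qed.

Lemma weight_lt_add2r p m n : weight_lt (m + p)%MM (n + p)%MM = weight_lt m n.
Proof. by rewrite /weight_lt !omD ltn_add2r eqn_add2r ltmc_add2l. Qed.

Lemma weight_lt_wf : well_founded weight_lt.
Proof.
suff wf d m : (om m < d)%N -> Acc weight_lt m by move=> m; apply: wf (ltnSn _).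
elim: d m => [//|d IHd]; apply: (@ltmwf r (fun m => (om m < d.+1)%N -> _)).
move=> m IHm md; constructor=> n /orP[nm|/andP[/eqP nm lt_nm]].
  by apply: IHd; apply: leq_trans nm _.
by apply: IHm lt_nm _; rewrite nm.
Qed.

Definition weight_order : monomial_order r :=
  MonomialOrder weight_lt_irr weight_lt_trans weight_lt_total weight_lt_add2r
    weight_lt_wf.

End WeightOrder.

(** One element of [P] is chosen for each value of [f] attained on [P]; [classic] decides which
    values are attained. *)
Lemma finite_transversal (T : eqType) (F : finType) (f : T -> F)
    (P : T -> Prop) :
  exists s : seq T, [/\ (size s <= #|F|)%N, forall x, x \in s -> P x &
    forall x, P x -> exists2 y, y \in s & f y = f x].
Proof.
suff [s [ss sP Ps]] : exists s : seq T, [/\ (size s <= size (enum F))%N,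
    forall x, x \in s -> P x &
    forall x, P x -> f x \in enum F -> exists2 y, y \in s & f y = f x].
  exists s; rewrite cardE; split=> // x Px.
  by apply: Ps => //; rewrite mem_enum.
elim: (enum F) => [|c l [s [ss sP Ps]]]; first by exists [::].
have [[x [Px fx]]|nox] := classic (exists x, P x /\ f x = c).
  exists (x :: s); split=> // [y|y Py].
    by rewrite inE => /predU1P[->|/sP].
  rewrite inE => /predU1P[->|/(Ps y Py)[z zs <-]].
    by exists x; rewrite ?mem_head.
  by exists z; rewrite // inE zs orbT.
exists s; split=> // [|y Py]; first exact: leqW.
by rewrite inE => /predU1P[fy|/(Ps y Py)//]; case: nox; exists y.
Qed.

(** * Nonstandard monomials and their minimal elements *)

Section SemigroupDegree.
Variables (a : seq nat).
Local Notation r := (size a).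

Definition sdeg (m : 'X_{1..r}) : nat := (\sum_(j < r) m j * nth 0 a j)%N.

Lemma sdegD m n : sdeg (m + n)%MM = (sdeg m + sdeg n)%N.
Proof.
by rewrite /sdeg -big_split; apply: eq_bigr => j _; rewrite mnmDE mulnDl.
Qed.

Lemma sdegMn m k : sdeg (m *+ k)%MM = (sdeg m * k)%N.
Proof.
by rewrite /sdeg big_distrl; apply: eq_bigr => j _; rewrite mulmnE mulnAC.
Qed.

Lemma sdeg1 j : sdeg U_(j) = nth 0%N a j.
Proof.
rewrite /sdeg (bigD1 j) //= big1 ?addn0; first by rewrite mnm1E eqxx mul1n.
by move=> i ij; rewrite mnm1E eq_sym (negPf ij).
Qed.

Variable lt : monomial_order r.

(** This says that x^m - x^n lies in I_H and that its initial form has leading monomial x^m. *)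
Definition better (n m : 'X_{1..r}) : bool :=
  (sdeg n == sdeg m) &&
  ((mdeg m < mdeg n)%N || (mdeg m == mdeg n) && lt n m).

Definition nonstandard (m : 'X_{1..r}) : Prop := exists n, better n m.

Definition min_nonstandard (m : 'X_{1..r}) : Prop :=
  nonstandard m /\ forall p, nonstandard p -> (p <= m)%MM -> p = m.

Lemma better_add2r p n m : better (n + p)%MM (m + p)%MM = better n m.
Proof.
by rewrite /better !sdegD !mdegD !eqn_add2r ltn_add2r mo_add2r.
Qed.

Lemma better_trans : transitive better.
Proof.
move=> n p m /andP[/eqP pn hpn] /andP[/eqP nm hnm].
rewrite /better pn nm eqxx /=.
move: hnm hpn => /orP[mn|/andP[/eqP-> mn]].
  by case/orP=> [np|/andP[/eqP<- _]]; rewrite ?mn ?(ltn_trans mn np).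
by case/orP=> [->//|/andP[-> np]]; rewrite (mo_trans np mn) orbT.
Qed.

Lemma nonstandard_le p m : (p <= m)%MM -> nonstandard p -> nonstandard m.
Proof.
move=> pm [n np]; exists (n + (m - p))%MM.
by rewrite -{2}(submK pm) addmC (addmC _ p) addmC better_add2r.
Qed.

(** A common variable could be cancelled from both, leaving a nonstandard proper divisor of the
    minimal [m]. *)
Lemma better_disjoint n m i : min_nonstandard m -> better n m ->
  m i = 0%N \/ n i = 0%N.
Proof.
move=> [_ mmin] nm; case: (eqVneq (m i) 0%N) => [|mi]; first by left.
case: (eqVneq (n i) 0%N) => [|ni]; first by right.
have mi' : (U_(i) <= m)%MM by rewrite lep1mP.
have ni' : (U_(i) <= n)%MM by rewrite lep1mP.
have /mmin/(_ (lem_subr _ _)) mE : nonstandard (m - U_(i))%MM.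
  by exists (n - U_(i))%MM; rewrite -(better_add2r U_(i)) !submK.
have := congr1 mdeg (submK mi'); rewrite mE mdegD mdeg1 addn1.
by move/eqP; rewrite eqn_leq ltnn.
Qed.

Lemma ex_min_nonstandard m : nonstandard m ->
  exists2 p, min_nonstandard p & (p <= m)%MM.
Proof.
have [d] := ubnP (mdeg m); elim: d m => // d IHd m md nm.
have [mmin|] := classic (min_nonstandard m).
  by exists m; rewrite ?lepm_refl.
move=> nmin.
have [//|noq] := classic (exists2 p, min_nonstandard p & (p <= m)%MM).
case: nmin; split=> // p np pm; apply/eqP/contraT => pm'; case: noq.
have [|q qmin qp] := IHd p _ np; last by exists q; rewrite // (lepm_trans qp).
have := congr1 mdeg (submK pm); rewrite mdegD => mE.
rewrite -ltnS (leq_trans _ md) // ltnS -mE -[X in (X < _)%N]add0n ltn_add2r.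
rewrite lt0n mdeg_eq0.
by apply: contraNneq pm' => mp; rewrite -(submK pm) mp add0m.
Qed.

Hypothesis a_gt0 : all (ltn 0) a.

Lemma mdeg_le_sdeg m : (mdeg m <= sdeg m)%N.
Proof.
rewrite mdegE; apply: leq_sum => j _.
by rewrite leq_pmulr //; apply: (allP a_gt0); apply: mem_nth.
Qed.

(** Successive improvement stops: the degree can only grow, it is bounded by [sdeg m], and within
    one degree [lt] is well-founded. *)
Lemma ex_best m : nonstandard m -> exists2 n, better n m & ~ nonstandard n.
Proof.
have [d] := ubnP (sdeg m - mdeg m); elim: d m => // d IHd m.
elim/(well_founded_ind (mo_wf lt)): m => m IHm md [n nm].
have [nn|] := classic (nonstandard n); last by exists n.
suff [p pn np] : exists2 p, better p n & ~ nonstandard p.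
  by exists p => //; apply: better_trans nm.
have := nm => /andP[/eqP snm /orP[dnm|/andP[/eqP dnm lnm]]].
  apply: IHd => //; rewrite -ltnS (leq_trans _ md) // ltnS snm ltn_sub2l //.
  by apply: leq_trans dnm _; rewrite -snm mdeg_le_sdeg.
by apply: IHm => //; rewrite snm -dnm.
Qed.

End SemigroupDegree.

(** * The Groebner basis of the tangent cone *)

Section IdealSpan.
Variables (K : fieldType) (r : nat).
Local Notation S := {mpoly K[r]}.
Implicit Types (G : S -> Prop).

Lemma ideal_span_ideal G :
  submodule (fun v : 'rV[S]_1 => ideal_span G (v 0 0)).
Proof.
split=> /= [|u v [s1 G1 uE] [s2 G2 vE]|c u [s Gs uE]].
- by exists [::]; rewrite ?mxE ?big_nil.
- exists (s1 ++ s2); last by rewrite mxE big_cat uE vE.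
  by move=> cg; rewrite mem_cat => /orP[/G1|/G2].
exists [seq (c * cg.1, cg.2) | cg <- s].
  by move=> _ /mapP[cg /Gs Gcg ->].
by rewrite mxE uE big_map mulr_sumr; apply: eq_bigr => cg _; rewrite mulrA.
Qed.

Lemma mem_ideal_span G g : G g -> ideal_span G g.
Proof.
move=> Gg; exists [:: (1, g)]; last by rewrite big_seq1 mul1r.
by move=> cg; rewrite inE => /eqP->.
Qed.

Lemma initial_degree_le (f : S) m : f@_m != 0 -> (initial_degree f <= mdeg m)%N.
Proof.
rewrite -mcoeff_msupp /initial_degree; elim: (msupp f) => // p s IHs.
by rewrite inE big_cons geq_min => /predU1P[->|/IHs->]; rewrite ?leqnn ?orbT.
Qed.

Lemma initial_degree_eq (f : S) m : f@_m != 0 ->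
  (forall p, f@_p != 0 -> (mdeg m <= mdeg p)%N) -> initial_degree f = mdeg m.
Proof.
move=> fm mmin; apply/eqP; rewrite eqn_leq initial_degree_le //=.
(* The minimum starts from the default [msize f], which must not fall below [mdeg m]. *)
have : (mdeg m <= msize f)%N by rewrite ltnW // msize_mdeg_lt ?mcoeff_msupp.
rewrite /initial_degree; have : {in msupp f, forall p, (mdeg m <= mdeg p)%N}.
  by move=> p; rewrite mcoeff_msupp; apply: mmin.
elim: (msupp f) => [|p s IHs] sP fsz; first by rewrite big_nil.
rewrite big_cons leq_min sP ?mem_head // IHs // => q qs.
by apply: sP; rewrite inE qs orbT.
Qed.

End IdealSpan.

Section TangentCone.
Variables (K : fieldType) (a : seq nat).
Local Notation r := (size a).
Local Notation S := {mpoly K[r]}.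
Local Notation I := (semigroup_ideal K a).
Local Notation J := (initial_ideal I).

Lemma mmap1_monomial (m : 'X_{1..r}) :
  mmap1 (fun j : 'I_r => 'X^(nth 0%N a j)) m = 'X^(sdeg m) :> {poly K}.
Proof.
rewrite /mmap1 /sdeg -prodrXr; apply: eq_bigr => j _.
by rewrite mulnC exprM.
Qed.

Lemma semigroup_ideal_coef f h : I f ->
  \sum_(m <- msupp f | sdeg m == h) f@_m = 0.
Proof.
move=> /(congr1 (fun p : {poly K} => p`_h)) /=.
rewrite coef0 /mmap coef_sum => E; rewrite -[RHS]E big_mkcond /=.
apply: eq_bigr => m _.
rewrite mmap1_monomial coefCM coefXn eq_sym.
by case: eqP; rewrite ?mulr1 ?mulr0.
Qed.

Definition cone_map : S -> {poly {poly K}} :=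
  mmap (polyC \o polyC) (fun j : 'I_r => ('X^(nth 0%N a j))%:P * 'X).

Definition cone_coef (d h : nat) (f : S) : K := ((cone_map f)`_d)`_h.

Lemma cone_mapX m : cone_map 'X_[m] = ('X^(sdeg m))%:P * 'X^(mdeg m).
Proof.
rewrite /cone_map mmapX -mmap1_monomial /mmap1 mdegE -prodrXr rmorph_prod.
by rewrite -big_split; apply: eq_bigr => j _; rewrite exprMn -polyC_exp.
Qed.

Lemma cone_coef_sum d h (s : seq 'X_{1..r}) P (c : 'X_{1..r} -> K) :
  cone_coef d h (\sum_(m <- s | P m) c m *: 'X_[m]) =
  \sum_(m <- s | [&& P m, mdeg m == d & sdeg m == h]) c m.
Proof.
rewrite /cone_coef /cone_map raddf_sum !coef_sum big_mkcond [RHS]big_mkcond /=.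
apply: eq_bigr => m _; case: (P m) => //=.
rewrite mmapZ /= -/(cone_map _) cone_mapX !coefCM coefXn eq_sym.
case: eqVneq => _ /=; last by rewrite mulr0 coef0 mulr0.
by rewrite mulr1 coefXn eq_sym; case: eqP; rewrite ?mulr1 ?mulr0.
Qed.

Lemma cone_coefE d h f :
  cone_coef d h f = \sum_(m <- msupp f | (mdeg m == d) && (sdeg m == h)) f@_m.
Proof. by rewrite {1}[f]mpolyE cone_coef_sum. Qed.

(* [cone_map] is the map x_j |-> t^(a_j) T. The polynomials all of whose
   coefficients at T^d t^h with d maximal for h vanish form the kernel of the map
   from S to the associated graded ring of K[H]. *)
Definition maximal_length (d h : nat) : Prop :=
  forall m : 'X_{1..r}, sdeg m = h -> (mdeg m <= d)%N.

Definition cone_vanishing (f : S) : Prop :=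
  forall d h, maximal_length d h -> cone_coef d h f = 0.

(** If d is the initial degree of [f] and maximal for h, every term of [f] over t^h has degree
    exactly d. The coefficient is then that of t^h in the image of [f], which is 0. For any other d
    the sum is empty. *)
Lemma cone_vanishing_initial_form f : I f -> cone_vanishing (initial_form f).
Proof.
move=> If d h dmax; rewrite /initial_form pihomogE cone_coef_sum.
have [dE|dne] := eqVneq (initial_degree f) d; last first.
  rewrite big_pred0 // => m; apply/negP=> /and3P[/eqP e1 /eqP e2 _].
  by case/eqP: dne; apply: etrans (esym e1) e2.
rewrite -[RHS](semigroup_ideal_coef h If) big_seq_cond [RHS]big_seq_cond.
apply: eq_bigl => m; rewrite mcoeff_msupp dE.
have [//|fm] := eqVneq f@_m 0.
case: (eqVneq (sdeg m) h) => [mh|]; rewrite ?andbF //=.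
by rewrite !andbT andbb eqn_leq dmax //= -dE initial_degree_le.
Qed.

(** If a monomial has degree i and image t^j, then d - i is maximal for h - j: a longer monomial
    there, multiplied by the first, would exceed d. So each term of the convolution vanishes. *)
Lemma cone_vanishing_mul p f : cone_vanishing f -> cone_vanishing (p * f).
Proof.
move=> vf d h dmax; rewrite /cone_coef /cone_map rmorphM.
rewrite -/(cone_map p) -/(cone_map f).
rewrite coefM coef_sum big1 // => i _; rewrite coefM big1 // => j _.
have [->|] := eqVneq (((cone_map p)`_i)`_j) 0; first by rewrite mul0r.
rewrite -/(cone_coef i j p) cone_coefE => nz.
have [m [mi mj]] : exists m : 'X_{1..r}, mdeg m = i /\ sdeg m = j.
  have [//|nom] := classic (exists m : 'X_{1..r}, mdeg m = i /\ sdeg m = j).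
  rewrite big_pred0 ?eqxx // in nz => m; apply/negP=> /andP[/eqP mi /eqP mj].
  by case: nom; exists m.
rewrite -/(cone_coef (d - i) (h - j) f) vf ?mulr0 // => n nh.
rewrite leq_subRL; last by rewrite -ltnS ltn_ord.
rewrite -mi -mdegD; apply: dmax; rewrite sdegD mj nh subnKC //.
by rewrite -ltnS ltn_ord.
Qed.

Lemma initial_ideal_vanishing f : J f -> cone_vanishing f.
Proof.
case=> s hs -> d h dmax; rewrite /cone_coef /cone_map raddf_sum !coef_sum.
rewrite big_seq big1 // => cg /hs[f' [If' _ ->]].
exact: cone_vanishing_mul (cone_vanishing_initial_form If') _ _ dmax.
Qed.

Variable lt : monomial_order r.

(** For standard [m], [mdeg m] is maximal for [sdeg m], so the coefficients of [f] with these two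
    degrees sum to 0. Any other monomial among them is smaller for [lt], hence better than [m]; only
    the nonzero coefficient at [m] would remain. *)
Lemma lead_nonstandard f m : J f -> f@_m != 0 ->
  (forall p, f@_p != 0 -> p != m -> lt p m) -> nonstandard lt m.
Proof.
move=> Jf fm lead; have [//|std] := classic (nonstandard lt m).
have maxm : maximal_length (mdeg m) (sdeg m).
  move=> p pm; rewrite leqNgt; apply/negP=> mp; case: std; exists p.
  by rewrite /better pm eqxx mp.
have := initial_ideal_vanishing Jf maxm; rewrite cone_coefE big_mkcond /=.
rewrite (bigD1_seq m) ?msupp_uniq ?mcoeff_msupp //= !eqxx.
rewrite big1_seq ?addr0 => [/eqP|p].
  by rewrite (negPf fm).
rewrite mcoeff_msupp => /andP[pm fp]; case: ifP => // /andP[/eqP dp /eqP sp].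
by case: std; exists p; rewrite /better sp dp !eqxx lead ?orbT.
Qed.

(** The initial form of x^m - x^n when [n] is better than [m]. *)
Definition cone_binomial (m n : 'X_{1..r}) : S :=
  'X_[m] - (if mdeg n == mdeg m then 'X_[n] else 0).

Lemma better_neq n m : better lt n m -> n != m.
Proof.
rewrite /better; apply: contraTneq => ->.
by rewrite ltnn mo_irr andbF andbF.
Qed.

Lemma mem_cone_binomial m n : better lt n m -> J (cone_binomial m n).
Proof.
move=> nm; have n_m := better_neq nm.
have fE p : ('X_[m] - 'X_[n] : S)@_p = (m == p)%:R - (n == p)%:R.
  by rewrite mcoeffB !mcoeffX.
have fm : ('X_[m] - 'X_[n] : S)@_m != 0.
  by rewrite fE eqxx (negPf n_m) subr0 oner_eq0.
move: nm => /andP[/eqP snm hnm]; have dmn : (mdeg m <= mdeg n)%N.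
  by case/orP: hnm => [/ltnW|/andP[/eqP->]].
apply: mem_ideal_span; exists ('X_[m] - 'X_[n]); split.
- by rewrite /semigroup_ideal mmapB !mmapX !mmap1_monomial snm subrr.
- by apply/eqP=> f0; rewrite f0 mcoeff0 eqxx in fm.
rewrite /initial_form (@initial_degree_eq _ _ _ m) //; last first.
  move=> p; rewrite fE; have [<- //|_] := eqVneq m p.
  by have [<- //|_] := eqVneq n p; rewrite subrr eqxx.
by rewrite pihomogB !pihomogX eqxx.
Qed.

(** Each [m] in [s] contributes the cone binomial of [m] and some better monomial;
    [lead_nonstandard] shows that their leading monomials suffice. *)
Lemma tangent_cone_groebner (s : seq 'X_{1..r}) :
  (forall m, m \in s -> nonstandard lt m) ->
  (forall m, nonstandard lt m -> exists2 p, p \in s & (p <= m)%MM) ->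
  exists g : groebner lt (fun=> 0%MM) (fun=> 0%N)
    (fun v : 'rV[S]_1 => J (v 0 0)),
    gb_size g = size s.
Proof.
move=> sP Ps; pose t (i : 'I_(size s)) := nth 0%MM s i.
have [u tu] := fin_all_exists (fun i => sP (t i) (mem_nth _ (ltn_ord i))).
pose A : 'M[S]_(size s, 1) := \matrix_(i, _) cone_binomial (t i) (u i).
have coefA i p : vcoef (row i A) p =
    (t i == p.2)%:R - (if mdeg (u i) == mdeg (t i) then (u i == p.2)%:R else 0).
  rewrite /vcoef !mxE mcoeffB mcoeffX; case: ifP => _; last by rewrite mcoeff0.
  by rewrite mcoeffX.
have monic i : vcoef (row i A) (ord0, t i) = 1.
  rewrite coefA /= eqxx (negPf (better_neq (tu i))).
  by case: ifP; rewrite subr0.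
unshelve eexists.
  apply: (@Groebner _ _ _ _ _ _ _ (size s) A (fun i => (ord0, t i))) => //.
  - by move=> i; rewrite !mxE; apply: mem_cone_binomial.
  - move=> i; split=> [|[j p]]; first by rewrite monic oner_eq0.
    rewrite (ord1 j) coefA /= => + ne; have [tp|_] := eqVneq (t i) p.
      by rewrite tp eqxx in ne.
    rewrite sub0r oppr_eq0; case: ifP => [/eqP de|]; last by rewrite eqxx.
    have [<- _|] := eqVneq (u i) p; last by rewrite eqxx.
    rewrite /mlt /klt /mkey /= !addm0.
    by have /andP[_] := tu i; rewrite de ltnn eqxx => /= ->.
  move=> v [j m] Jv [vm vlead]; rewrite (ord1 j) in vm vlead *.
  have /Ps[p ps pm] : nonstandard lt m.
    apply: (lead_nonstandard Jv vm) => p vp pm.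
    have := vlead (ord0, p) vp; rewrite xpair_eqE eqxx => /(_ pm).
    by rewrite /mlt /klt /mkey /= !addm0 ltnn andbF orbF.
  have pi : (index p s < size s)%N by rewrite index_mem.
  by exists (Ordinal pi); rewrite /t /= nth_index.
by [].
Qed.

End TangentCone.

(** * Counting the minimal nonstandard monomials *)

Section Counting.
Variables (a : seq nat).
Local Notation r := (size a).

(** The weight that puts all variables but the first and the last in front, so that powers of middle
    variables lead in homogeneous relations. *)
Definition middle_degree (m : 'X_{1..r}) : nat :=
  (\sum_(j < r | (0 < j < r.-1)%N) m j)%N.

Lemma middle_degreeD m n :
  middle_degree (m + n)%MM = (middle_degree m + middle_degree n)%N.
Proof.
by rewrite /middle_degree -big_split; apply: eq_bigr => j _; rewrite mnmDE.
Qed.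

Lemma middle_degreeMn m k : middle_degree (m *+ k)%MM = (middle_degree m * k)%N.
Proof.
by rewrite /middle_degree big_distrl; apply: eq_bigr => j _; rewrite mulmnE.
Qed.

Lemma middle_degree1 i : middle_degree U_(i)%MM = (0 < i < r.-1)%N.
Proof.
rewrite /middle_degree big_mkcond (bigD1 i) //= big1 ?addn0 => [|j ji].
  by rewrite mnm1E eqxx; case: ifP.
by rewrite mnm1E eq_sym (negPf ji); case: ifP.
Qed.

Definition middle_order : monomial_order r := weight_order middle_degreeD.

Local Notation nonstandard := (nonstandard middle_order).
Local Notation min_nonstandard := (min_nonstandard middle_order).

Variable w : nat.
Hypotheses (a_gt0 : all (ltn 0) a) (a_sorted : sorted ltn a).
Hypothesis aw : (width a <= w)%N.

Lemma nth_ltn i j : (i < j)%N -> (j < r)%N -> (nth 0 a i < nth 0 a j)%N.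
Proof.
move=> ij jr.
by rewrite (sorted_ltn_nth ltn_trans) // inE // (ltn_trans ij).
Qed.

Lemma widthE : width a = (nth 0 a r.-1 - nth 0 a 0)%N.
Proof. by rewrite /width nth_last nth0. Qed.

(** The generators are strictly increasing integers, so r of them spread over at least r - 1. *)
Lemma size_le_width : (r <= w.+1)%N.
Proof.
have le_nth i : (i < r)%N -> (nth 0 a 0 + i <= nth 0 a i)%N.
  elim: i => [|i IHi] ir; first by rewrite addn0.
  by rewrite addnS; apply: leq_ltn_trans (IHi (ltnW ir)) (nth_ltn _ ir).
case: (posnP r) => [->//|r0]; rewrite -(prednK r0) ltnS.
apply: leq_trans aw; rewrite widthE.
by rewrite leq_subRL ?le_nth ?prednK // (leq_trans _ (le_nth _ _)) ?leq_addr
  ?prednK.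
Qed.

(* x_j^(a_l - a_0) is traded for x_0^(a_l - a_j) x_l^(a_j - a_0), where x_l is
   the last variable: same degree, same image in K[t]. *)
Lemma middle_power_nonstandard (j : 'I_r) : (0 < j < r.-1)%N ->
  nonstandard (U_(j) *+ width a)%MM.
Proof.
move=> jmid; have /andP[j0 jl] := jmid.
have r0 : (0 < r)%N by apply: leq_ltn_trans (ltn_ord j).
have lr : (r.-1 < r)%N by rewrite prednK.
pose i0 := Ordinal r0; pose il := Ordinal lr.
have a0j := nth_ltn j0 (ltn_ord j); have ajl := nth_ltn jl lr.
have wE : width a = (nth 0 a r.-1 - nth 0 a j + (nth 0 a j - nth 0 a 0))%N.
  by rewrite widthE addnBA 1?ltnW // subnK // ltnW.
move: wE; set z := nth 0%N a r.-1 in ajl *; set y := nth 0%N a j in a0j ajl *.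
set x := nth 0%N a 0 in a0j * => wE.
exists (U_(i0) *+ (z - y) + U_(il) *+ (y - x))%MM.
rewrite /better sdegD mdegD !sdegMn !mdegMn !sdeg1 !mdeg1 !mul1n.
rewrite -/x -/y -/z -wE eqxx ltnn /= /weight_lt middle_degreeD !middle_degreeMn.
rewrite !middle_degree1 /= jmid ltnn andbF !mul0n mul1n wE addn_gt0 subn_gt0.
(* What remains is x (z - y) + z (y - x) = y ((z - y) + (y - x)). *)
rewrite ajl andbT -(subnKC (ltnW ajl)) -(subnKC (ltnW a0j)); move: (y - x)%N => d.
by rewrite !addKn !mulnDl !mulnDr -!addnA (mulnC d (_ - _)%N) (addnC (d * d)%N).
Qed.

Lemma standard_middle m (j : 'I_r) : ~ nonstandard m -> (0 < j < r.-1)%N ->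
  (m j < width a)%N.
Proof.
move=> std jmid; rewrite ltnNge; apply/negP=> wm; case: std.
apply: nonstandard_le (middle_power_nonstandard jmid).
apply/mnm_lepP=> i; rewrite mulmnE mnm1E.
by case: eqVneq => [<-|_]; rewrite ?mul1n ?mul0n.
Qed.

Lemma min_nonstandard_middle m (j : 'I_r) : min_nonstandard m ->
  (0 < j < r.-1)%N -> (m j <= w)%N.
Proof.
move=> [_ mmin] jmid; apply: leq_trans aw; rewrite leqNgt; apply/negP=> wm.
have /mmin mE := middle_power_nonstandard jmid.
suff /mE mE' : (U_(j) *+ width a <= m)%MM.
  by move: wm; rewrite -mE' mulmnE mnm1E eqxx mul1n ltnn.
apply/mnm_lepP=> i; rewrite mulmnE mnm1E.
by case: eqVneq => [<-|_]; rewrite ?mul1n ?mul0n // ltnW.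
Qed.

(** At most w + 1 variables with exponents at most w give a degree below W. *)
Local Notation W := (w.+1 * w).+1.

(* If both extreme variables divide [m] then, by minimality, neither divides a
   best monomial [n] for [m], so that [n] has bounded degree. *)
Lemma min_nonstandard_mdeg m (i j : 'I_r) : min_nonstandard m ->
  i = 0%N :> nat -> j = r.-1 :> nat -> m i != 0%N -> m j != 0%N ->
  (mdeg m < W)%N.
Proof.
move=> mmin i0 jl mi mj; have [n nm std] := ex_best a_gt0 (proj1 mmin).
have cancel k : m k != 0%N -> n k = 0%N.
  by move=> mk; case: (better_disjoint k mmin nm) => // /eqP; rewrite (negPf mk).
have ni := cancel i mi; have nj := cancel j mj.
have mn : (mdeg m <= mdeg n)%N.
  by have /andP[_ /orP[/ltnW|/andP[/eqP->]]] := nm.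
rewrite ltnS (leq_trans mn) // mdegE.
apply: (@leq_trans (\sum_(k < r) w)%N); last first.
  by rewrite sum_nat_const card_ord leq_mul2r size_le_width orbT.
apply: leq_sum => k _.
have [ki|k0] := eqVneq k i; first by rewrite ki ni.
have [kj|kl] := eqVneq k j; first by rewrite kj nj.
rewrite (leq_trans (ltnW (standard_middle std _))) // lt0n -i0 k0 /=.
rewrite ltn_neqAle -{1}jl kl -ltnS prednK ?ltn_ord //.
exact: leq_ltn_trans (ltn_ord k).
Qed.

(** The value W stands for every exponent that is at least W. *)
Definition truncation (m : 'X_{1..r}) : {ffun 'I_r -> 'I_W.+1} :=
  [ffun j => inord (minn (m j) W)].

Lemma truncationP m n j : truncation m = truncation n ->
  minn (m j) W = minn (n j) W.
Proof.
move/ffunP/(_ j); rewrite !ffunE => /(congr1 val) /=.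
by rewrite !inordK // ltnS geq_minr.
Qed.

(** Monomials that differ in one exponent only are comparable for divisibility, and minimality
    forces equality. *)
Lemma min_nonstandard_comparable m n (j : 'I_r) :
  min_nonstandard m -> min_nonstandard n ->
  (forall i, i != j -> m i = n i) -> m = n.
Proof.
have le p q : min_nonstandard p -> min_nonstandard q -> (p j <= q j)%N ->
    (forall i, i != j -> p i = q i) -> p = q.
  move=> [np _] [_ qmin] pq e; apply: qmin np _.
  by apply/mnm_lepP=> i; have [->//|/e->] := eqVneq i j.
move=> mm nn e; have [/le|/ltnW/le] := leqP (m j) (n j); first by apply.
by move=> H; symmetry; apply: H => // i ij; rewrite e.
Qed.

Lemma truncation_inj m n : min_nonstandard m -> min_nonstandard n ->
  truncation m = truncation n -> m = n.
Proof.
move=> mmin nmin mn; have eqW j : (m j < W)%N -> m j = n j.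
  move=> mW; have := truncationP j mn; rewrite (minn_idPl (ltnW mW)).
  by case: (leqP (n j) W) => // _ mE; move: mW; rewrite mE ltnn.
have [r0|r0] := posnP r.
  by apply/mnmP=> j; have := ltn_ord j; rewrite [X in (_ < X)%N]r0.
have lr : (r.-1 < r)%N by rewrite prednK.
pose i0 := Ordinal r0; pose il := Ordinal lr.
have middle j : j != i0 -> j != il -> m j = n j.
  move=> j0 jl; apply: eqW; rewrite ltnS.
  apply: leq_trans (min_nonstandard_middle mmin _) _; last exact: leq_pmull.
  rewrite lt0n; move: j0 jl; rewrite -!val_eqE /= => -> jl /=.
  by rewrite ltn_neqAle jl -ltnS prednK ?ltn_ord.
(* If the first exponent is below W, only the last can differ; otherwise the last exponent is 0 in
   both, and only the first can differ. *)
have [mW|Wm] := ltnP (m i0) W.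
  apply: (min_nonstandard_comparable mmin nmin (j := il)) => j jl.
  have [->|j0] := eqVneq j i0; [exact: eqW|exact: middle].
have Wn : (W <= n i0)%N.
  by have := truncationP i0 mn; rewrite (minn_idPr Wm) => /esym/minn_idPr.
apply: (min_nonstandard_comparable mmin nmin (j := i0)) => j j0.
have [->|jl] := eqVneq j il; last exact: middle.
(* Were the last variable present too, the degree would be below W by [min_nonstandard_mdeg]. *)
have last0 p : min_nonstandard p -> (W <= p i0)%N -> p il = 0%N.
  move=> pmin Wp; apply/eqP/contraT => pl.
  have := min_nonstandard_mdeg pmin (erefl : i0 = 0%N :> nat)
    (erefl : il = r.-1 :> nat) _ pl.
  rewrite -lt0n (leq_trans _ Wp) // => /(_ isT); rewrite ltnNge mdegE.
  by rewrite (leq_trans Wp) // (bigD1 i0) //= leq_addr.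
by rewrite !last0.
Qed.

Lemma nonstandard_generators : exists s : seq 'X_{1..r},
  [/\ (size s <= W.+1 ^ w.+1)%N, forall m, m \in s -> nonstandard m &
    forall m, nonstandard m -> exists2 p, p \in s & (p <= m)%MM].
Proof.
have [s [ss sP Ps]] := finite_transversal truncation min_nonstandard.
exists s; split=> [|m /sP[]//|m /ex_min_nonstandard[p pmin pm]].
  apply: leq_trans ss _; rewrite card_ffun !card_ord leq_exp2l //.
  exact: size_le_width.
have [q qs qp] := Ps p pmin; exists q => //.
by rewrite (truncation_inj (sP q qs) pmin qp).
Qed.

End Counting.

Theorem corollary1p6 (K : fieldType) (w : nat) (hw : (2 <= w)%N) (i : nat) :
  exists b : int,
    forall (H : nat -> Prop) (a : seq nat),
      numerical_semigroup H -> minimal_generators a H -> (width a <= w)%N ->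
      exists2 n : nat,
        is_betti (initial_ideal (semigroup_ideal K a)) i n & (n%:Z <= b)%R.
Proof.
(* There are W + 1 truncated exponents for each of at most w + 1 variables, which bounds the
   Groebner basis; each of the i syzygy steps at most squares the bound. *)
exists ((((w.+1 * w).+2 ^ w.+1) ^ 2 ^ i)%N%:Z) => H a _ [apos asort _ _] aw.
have [s [ss sP Ps]] := nonstandard_generators apos asort aw.
have [g gs] := tangent_cone_groebner K sP Ps.
have subJ := ideal_span_ideal (K := K)
  (fun h => exists f, [/\ semigroup_ideal K a f, f != 0 & h = initial_form f]).
exists (tor_dim (schreyer_resolution subJ g) i).
  exact/is_betti_tor_dim/schreyer_resolutionP.
rewrite lez_nat (leq_trans (tor_dim_rk _ _)) //.
rewrite (leq_trans (schreyer_resolution_rk _ _ _)) // gs leq_exp2r //.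
by rewrite expn_gt0.
Qed.
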